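(* Let $\mathcal{A}$ be a complex unital algebra, let $\Phi,\Psi:\mathcal{A}\to\mathbb{C}$ be two linear maps with $\Phi(1)=\Psi(1)=1$, and let $X,Y\in\mathcal{A}$ be c-free with respect to $(\Phi,\Psi)$. Then: (i) $R_{X+Y}=R_X+R_Y$ and ${}^cR_{X+Y}={}^cR_X+{}^cR_Y$ as formal power series. (ii) If $\Psi(X)$ and $\Psi(Y)$ are nonzero, then $T_{XY}=T_X\cdot T_Y$ and ${}^cT_{XY}={}^cT_X\cdot{}^cT_Y$ as formal power series.
   Context: Let $\mathcal{A}$ be a complex unital algebra with linear maps $\Phi,\Psi:\mathcal{A}\to\mathbb{C}$, $\Phi(1)=\Psi(1)=1$. A family of unital subalgebras $\{\mathcal{A}_i\}_{i\in I}$ of $\mathcal{A}$ is free with respect to $\Psi$ if $\Psi(x_1\cdots x_n)=0$ whenever $x_j\in\mathcal{A}_{\epsilon(j)}$ and $\Psi(x_j)=0$ for $1\le j\le n$, and $\epsilon(k)\neq\epsilon(k+1)$ for $1\le k<n$. The family is c-free with respect to $(\Phi,\Psi)$ if it is free with respect to $\Psi$ and $\Phi(x_1\cdots x_n)=\Phi(x_1)\cdots\Phi(x_n)$ for all $x_1,\dots,x_n$ satisfying the same conditions (namely $x_j\in\mathcal{A}_{\epsilon(j)}$, $\Psi(x_j)=0$, $\epsilon(k)\ne\epsilon(k+1)$). Elements $X,Y$ are c-free if the unital subalgebras generated by $X$ and by $Y$ are c-free. For $X\in\mathcal{A}$ define the formal power series $m_X(z)=\sum_{k\ge1}\Psi(X^k)z^k$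 and $M_X(z)=\sum_{k\ge1}\Phi(X^k)z^k$. The transforms are the formal power series determined by $$m_X(z)=R_X\big(z[1+m_X(z)]\big),\qquad {}^cR_X\big(z[1+m_X(z)]\big)\cdot(1+M_X(z))=M_X(z)\,[1+m_X(z)],$$ and, if $\Psi(X)\ne0$, $$\tfrac1z m_X(z)=T_X(m_X(z))\cdot(1+m_X(z)),\qquad {}^cT_X(m_X(z))\cdot(1+M_X(z))=\tfrac1z M_X(z).$$ *)

(* Defs.v *)
From HB Require Import structures.
From mathcomp Require Import all_boot all_order all_algebra complex.
From mathcomp Require Import mathcomp_extra boolp classical_sets reals.

Set Implicit Arguments.
Unset Strict Implicit.
Unset Printing Implicit Defensive.

Import Order.TTheory GRing.Theory Num.Theory.
Local Open Scope ring_scope.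

(* A record rather than nat -> K, so that the Cauchy product does not clash with
   the pointwise ring structure on functions. *)
Record fps (K : Type) := FPS { fcoef : nat -> K }.
Arguments FPS {K} _.
Arguments fcoef {K} _ _.

HB.instance Definition _ (K : Type) := gen_eqMixin (fps K).
HB.instance Definition _ (K : Type) := gen_choiceMixin (fps K).

Lemma fpsP (K : Type) (f g : fps K) : fcoef f =1 fcoef g <-> f = g.
Proof. by split=> [|->//]; case: f g => [f] [g] /= /funext ->. Qed.

Section FpsRing.
Variable K : comNzRingType.
Implicit Types f g h : fps K.

Definition fps_zero : fps K := FPS (fun=> 0).
Definition fps_opp f := FPS (fun n => - fcoef f n).
Definition fps_add f g := FPS (fun n => fcoef f n + fcoef g n).

Let addA : associative fps_add.
Proof. by move=> f g h; apply/fpsP => n /=; rewrite addrA. Qed.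
Let addC : commutative fps_add.
Proof. by move=> f g; apply/fpsP => n /=; rewrite addrC. Qed.
Let add0 : left_id fps_zero fps_add.
Proof. by move=> f; apply/fpsP => n /=; rewrite add0r. Qed.
Let addN : left_inverse fps_zero fps_opp fps_add.
Proof. by move=> f; apply/fpsP => n /=; rewrite addNr. Qed.

HB.instance Definition _ :=
  GRing.isZmodule.Build (fps K) addA addC add0 addN.

Definition fps_one : fps K := FPS (fun n => (n == 0%N)%:R).
Definition fps_mul f g :=
  FPS (fun n => \sum_(k < n.+1) fcoef f k * fcoef g (n - k)%N).

Definition fps_trunc n f : {poly K} := \poly_(i < n.+1) fcoef f i.

Lemma fps_mul_trunc N n f g : (n <= N)%N ->
  fcoef (fps_mul f g) n = (fps_trunc N f * fps_trunc N g)`_n.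
Proof.
move=> nN; rewrite coefM; apply: eq_bigr => -[k /= kn] _.
rewrite !coef_poly !ltnS (leq_trans _ nN) ?(leq_trans (leq_subr _ _) nN) //.
Qed.

Let mulC : commutative fps_mul.
Proof. by move=> f g; apply/fpsP => n; rewrite !(fps_mul_trunc _ _ (leqnn n)) mulrC. Qed.
Let mulA : associative fps_mul.
Proof.
move=> f g h; apply/fpsP => n.
have -> : fcoef (fps_mul f (fps_mul g h)) n =
    (fps_trunc n f * (fps_trunc n g * fps_trunc n h))`_n.
  rewrite coefM; apply: eq_bigr => -[k /= kn] _.
  by rewrite coef_poly kn -fps_mul_trunc // leq_subr.
rewrite mulrA coefM; apply: eq_bigr => -[k /= kn] _.
by rewrite coef_poly ltnS leq_subr -fps_mul_trunc.
Qed.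
Let mul1 : left_id fps_one fps_mul.
Proof.
move=> f; apply/fpsP => n /=; rewrite big_ord_recl /= mul1r subn0 big1 ?addr0 //.
by move=> i _; rewrite mul0r.
Qed.
Let mulDl : left_distributive fps_mul fps_add.
Proof.
move=> f g h; apply/fpsP => n /=; rewrite -big_split /=.
by apply: eq_bigr => i _; rewrite mulrDl.
Qed.
Let one_neq0 : fps_one != fps_zero.
Proof. by apply/eqP => /fpsP/(_ 0%N)/eqP; rewrite /= oner_eq0. Qed.

HB.instance Definition _ :=
  GRing.Zmodule_isComNzRing.Build (fps K) mulA mulC mul1 mulDl one_neq0.

Definition fps_z : fps K := FPS (fun n => (n == 1%N)%:R).

(* This is f / z for a series f without constant term. *)
Definition fps_divz f : fps K := FPS (fun n => fcoef f n.+1).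

(* This is f(g(z)) for a series g without constant term: g ^+ k then has no
   term of order less than k, hence the bound on k. *)
Definition fps_comp f g : fps K :=
  FPS (fun n => \sum_(k < n.+1) fcoef f k * fcoef (g ^+ k) n).

Lemma fcoef0 n : fcoef (0 : fps K) n = 0. Proof. by []. Qed.
Lemma fcoef1 n : fcoef (1 : fps K) n = (n == 0%N)%:R. Proof. by []. Qed.
Lemma fcoefD f g n : fcoef (f + g) n = fcoef f n + fcoef g n.
Proof. by []. Qed.
Lemma fcoefN f n : fcoef (- f) n = - fcoef f n. Proof. by []. Qed.
Lemma fcoefM f g n :
  fcoef (f * g) n = \sum_(k < n.+1) fcoef f k * fcoef g (n - k)%N.
Proof. by []. Qed.

Lemma fps_divzK f : fcoef f 0 = 0 -> fps_z * fps_divz f = f.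
Proof.
move=> f0; apply/fpsP => -[|n]; rewrite fcoefM.
  by rewrite big_ord1 mul0r f0.
rewrite big_ord_recl mul0r add0r big_ord_recl /= mul1r subSS subn0 big1 ?addr0 //.
by move=> i _; rewrite mul0r.
Qed.

Lemma fcoefX_diag f n : fcoef f 0 = 0 -> fcoef (f ^+ n) n = fcoef f 1 ^+ n.
Proof.
move=> f0.
suff : (forall k, (k < n)%N -> fcoef (f ^+ n) k = 0) /\
    fcoef (f ^+ n) n = fcoef f 1 ^+ n by case.
elim: n => [|n [IH IHn]]; first by split.
rewrite exprS; split=> [k kn|].
  rewrite fcoefM big1 // => -[[|i] /= ik] _; first by rewrite f0 mul0r.
  by rewrite IH ?mulr0 //; case: k kn ik => // k kn ik; rewrite subSS (leq_ltn_trans (leq_subr _ _)).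
rewrite fcoefM big_ord_recl f0 mul0r add0r big_ord_recl /= subSS subn0 IHn.
rewrite big1 ?addr0 -?exprS // => -[i /= iN] _.
rewrite /bump /= !add1n subSS IH ?mulr0 //.
by rewrite ltn_subrL (leq_ltn_trans _ iN).
Qed.

End FpsRing.

Section Solve.
Variable K : fieldType.
Implicit Types f g h : fps K.

Let lower_triangular_solve (L : nat -> nat -> K) h : (forall n, L n n != 0) ->
  exists! f, FPS (fun n => \sum_(k < n.+1) fcoef f k * L n k) = h.
Proof.
move=> L0.
pose pre := fix pre n : seq K := if n is m.+1 then
  rcons (pre m) ((fcoef h m - \sum_(k < m) (pre m)`_k * L m k) / L m m) else [::].
have szpre n : size (pre n) = n by elim: n => //= n IH; rewrite size_rcons IH.
have preE n k : (k < n)%N -> (pre n)`_k = (pre k.+1)`_k.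
  elim: n => // n IH; rewrite ltnS leq_eqVlt => /predU1P[->//|kn].
  by rewrite -IH //= nth_rcons szpre kn.
exists (FPS (fun k => (pre k.+1)`_k)); split.
  apply/fpsP => n /=; rewrite big_ord_recr /= nth_rcons szpre ltnn eqxx divfK //.
  rewrite addrC -[RHS](subrK (\sum_(k < n) (pre n)`_k * L n k)); congr (_ + _).
  by apply: eq_bigr => -[k /= kn] _; rewrite (preE _ _ kn).
move=> f /fpsP fh; apply/fpsP => n /=.
elim/ltn_ind: n => n IH; rewrite nth_rcons szpre ltnn eqxx.
rewrite -fh /= big_ord_recr /=.
have -> : \sum_(k < n) (pre n)`_k * L n k = \sum_(k < n) fcoef f k * L n k.
  by apply: eq_bigr => -[k /= kn] _; rewrite (preE _ _ kn) -IH.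
by rewrite addrC addrK mulfK.
Qed.

Lemma fps_comp_solve g h : fcoef g 0 = 0 -> fcoef g 1 != 0 ->
  exists! f, fps_comp f g = h.
Proof.
move=> g0 g1; apply: (lower_triangular_solve (L := fun n k => fcoef (g ^+ k) n)) => n.
by rewrite fcoefX_diag // expf_neq0.
Qed.

Lemma fps_mul_solve u h : fcoef u 0 != 0 -> exists! f, f * u = h.
Proof.
move=> u0; apply: (lower_triangular_solve (L := fun n k => fcoef u (n - k)%N)) => n.
by rewrite subnn.
Qed.

Lemma fps_comp_mul_solve g u h :
  fcoef g 0 = 0 -> fcoef g 1 != 0 -> fcoef u 0 != 0 ->
  exists! f, fps_comp f g * u = h.
Proof.
move=> g0 g1 u0; have [k [ku kuniq]] := fps_mul_solve h u0.
have [f [fk funiq]] := fps_comp_solve k g0 g1.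
exists f; split=> [|f' /kuniq kE]; first by rewrite fk.
by apply: funiq.
Qed.

End Solve.

Section CFree.
Variables (R : realType) (A : algType R[i]).
Implicit Types (Phi Psi : {scalar A}).

Definition unital_subalgebra (B : set A) : Prop :=
  GRing.subalg_closed (fun x => x \in B).

Definition subalgebra_gen (X : A) : set A :=
  smallest unital_subalgebra [set X]%classic.

(* Only the first n values of eps and x matter. *)
Definition alternating_centred (I : Type) Psi (B : I -> set A)
    (n : nat) (eps : nat -> I) (x : nat -> A) : Prop :=
  (forall j, (j < n)%N -> B (eps j) (x j) /\ Psi (x j) = 0) /\
  (forall k, (k.+1 < n)%N -> eps k <> eps k.+1).

Definition free (I : Type) Psi (B : I -> set A) : Prop :=
  (forall i, unital_subalgebra (B i)) /\
  forall (n : nat) (eps : nat -> I) (x : nat -> A), (0 < n)%N ->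
    alternating_centred Psi B n eps x -> Psi (\prod_(j < n) x j) = 0.

Definition c_free (I : Type) Phi Psi (B : I -> set A) : Prop :=
  free Psi B /\
  forall (n : nat) (eps : nat -> I) (x : nat -> A), (0 < n)%N ->
    alternating_centred Psi B n eps x ->
    Phi (\prod_(j < n) x j) = \prod_(j < n) Phi (x j).

Definition c_free_elements Phi Psi (X Y : A) : Prop :=
  c_free Phi Psi
    (fun b : bool => if b then subalgebra_gen X else subalgebra_gen Y).

Lemma subalgebra_gen_unital X : unital_subalgebra (subalgebra_gen X).
Proof.
split.
- by rewrite unfold_in; apply/mem_set => B [[]]; rewrite unfold_in => /set_mem.
- move=> a u v; rewrite !unfold_in => /set_mem uX /set_mem vX.
  apply/mem_set => B BX; have /set_mem Bu := mem_set (uX B BX).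
  case: (BX) => -[_ lB _] _; have := lB a u v; rewrite !unfold_in => lB'.
  by apply/set_mem/lB'; apply/mem_set => //; apply: vX.
- move=> u v; rewrite !unfold_in => /set_mem uX /set_mem vX.
  apply/mem_set => B BX; case: (BX) => -[_ _ mB] _.
  have := mB u v; rewrite !unfold_in => mB'.
  by apply/set_mem/mB'; apply/mem_set; [apply: uX|apply: vX].
Qed.

End CFree.

Section Transforms.
Variables (R : realType) (A : algType R[i]).
Implicit Types (Phi Psi : {scalar A}) (X : A).

(* This is m_X for the functional Psi and M_X for the functional Phi. *)
Definition moment_series Phi X : fps R[i] :=
  FPS (fun k => if k is 0 then 0 else Phi (X ^+ k)).

Definition is_R Psi X (r : fps R[i]) : Prop :=
  let m := moment_series Psi X in
  m = fps_comp r (fps_z _ * (1 + m)).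

Definition is_cR Phi Psi X (r : fps R[i]) : Prop :=
  let m := moment_series Psi X in
  let M := moment_series Phi X in
  fps_comp r (fps_z _ * (1 + m)) * (1 + M) = M * (1 + m).

Definition is_T Psi X (t : fps R[i]) : Prop :=
  let m := moment_series Psi X in
  fps_divz m = fps_comp t m * (1 + m).

Definition is_cT Phi Psi X (t : fps R[i]) : Prop :=
  let m := moment_series Psi X in
  let M := moment_series Phi X in
  fps_comp t m * (1 + M) = fps_divz M.

(* By the existence and uniqueness lemmas below, the default value 0 is only
   relevant for T and cT at an X such that Psi X = 0. *)
Definition R_transform Psi X : fps R[i] := xget 0 (is_R Psi X).
Definition cR_transform Phi Psi X : fps R[i] := xget 0 (is_cR Phi Psi X).
Definition T_transform Psi X : fps R[i] := xget 0 (is_T Psi X).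
Definition cT_transform Phi Psi X : fps R[i] := xget 0 (is_cT Phi Psi X).

Let coef_one_moment Phi X : fcoef (1 + moment_series Phi X) 0 != 0.
Proof. by rewrite fcoefD fcoef1 addr0 oner_neq0. Qed.

Let coef_arg0 Psi X : fcoef (fps_z _ * (1 + moment_series Psi X)) 0 = 0.
Proof. by rewrite fcoefM big_ord1 mul0r. Qed.

Let coef_arg1 Psi X : fcoef (fps_z _ * (1 + moment_series Psi X)) 1 != 0.
Proof.
by rewrite fcoefM big_ord_recl big_ord1 mul0r add0r mul1r fcoefD addr0 oner_neq0.
Qed.

Lemma R_transform_unique Psi X : exists! r, is_R Psi X r.
Proof.
have [r [rE rU]] := fps_comp_solve (moment_series Psi X)
  (coef_arg0 Psi X) (coef_arg1 Psi X).
by exists r; split=> // r' /esym/rU.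
Qed.

Lemma cR_transform_unique Phi Psi X : exists! r, is_cR Phi Psi X r.
Proof. exact: fps_comp_mul_solve. Qed.

Lemma T_transform_unique Psi X : Psi X <> 0 -> exists! t, is_T Psi X t.
Proof.
move=> /eqP X0; set m := moment_series Psi X.
have m1 : fcoef m 1 != 0 by [].
have [t [tE tU]] := fps_comp_mul_solve (fps_divz m) (erefl : fcoef m 0 = 0) m1
  (coef_one_moment Psi X).
by exists t; split=> // t' /esym/tU.
Qed.

Lemma cT_transform_unique Phi Psi X : Psi X <> 0 -> exists! t, is_cT Phi Psi X t.
Proof. by move=> /eqP X0; apply: fps_comp_mul_solve. Qed.

Lemma R_transformP Psi X : is_R Psi X (R_transform Psi X).
Proof. by have [r [rE _]] := R_transform_unique Psi X; apply: (xgetI _ rE). Qed.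

Lemma cR_transformP Phi Psi X : is_cR Phi Psi X (cR_transform Phi Psi X).
Proof. by have [r [rE _]] := cR_transform_unique Phi Psi X; apply: (xgetI _ rE). Qed.

Lemma T_transformP Psi X : Psi X <> 0 -> is_T Psi X (T_transform Psi X).
Proof. by move=> /T_transform_unique[t [tE _]]; apply: (xgetI _ tE). Qed.

Lemma cT_transformP Phi Psi X :
  Psi X <> 0 -> is_cT Phi Psi X (cT_transform Phi Psi X).
Proof. by move=> /(cT_transform_unique Phi)[t [tE _]]; apply: (xgetI _ tE). Qed.

End Transforms.

(* Main.v *)
Require Import Defs.
From mathcomp Require Import all_boot all_order all_algebra complex.
From mathcomp Require Import mathcomp_extra boolp classical_sets reals.
From HB Require Import structures.
From mathcomp Require Import ring zify.
Import Order.TTheory GRing.Theory Num.Theory.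
Local Open Scope ring_scope.

Set Implicit Arguments.
Unset Strict Implicit.
Unset Printing Implicit Defensive.

(* For power series s, d in u put p = s X - d and zeta = u s / (1 + u d). Since
   (1 + u d) (1 - zeta X) = 1 - u p, the moment series at zeta are Psi and Phi of
   the resolvent a = (1 - u p)^-1 times 1 + u d. Hence r is the R-transform of X
   iff Psi(a) = 1 for s = 1, d = r/u, and t is its T-transform iff Psi(a) = 1 for
   s = 1/t, d = 1; the c-transforms are affine functions of 1 / Phi(a).

   Let a, b be the resolvents of p (from X) and q (from Y), with Psi(a) = Psi(b) = 1,
   so that x = a p and y = b q have Psi-centred coefficients. For k without constant
   term,
     1 - u (p + q) + (u^2 - k) p q = a^-1 (1 - k x y) b^-1,
   whose inverse b (1 - k x y)^-1 a is 1 plus a series of alternating centred words.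
   So Psi of it is 1, and Phi of it is Phi(a) Phi(b) / (1 - k Phi(x) Phi(y)). The
   left side is 1 - u p' with p' = p + q, belonging to X + Y, for k = u^2, and with
   1 + p' = (1 + p) (1 + q), belonging to X Y, for k = u (1 + u). *)

(** * Composition of formal power series *)

Section FpsComposition.
Variable K : comNzRingType.
Implicit Types (f g h : fps K) (p : {poly K}).

Local Notation z := (fps_z K).

Lemma fcoef_exp_lt f n k : fcoef f 0 = 0 -> (k < n)%N -> fcoef (f ^+ n) k = 0.
Proof.
move=> f0; elim: n k => // n IH k kn; rewrite exprS fcoefM big1 // => -[[|i] ik] _ /=.
  by rewrite f0 mul0r.
by rewrite IH ?mulr0 //; lia.
Qed.

Lemma fps_zM_inj f g : z * f = z * g -> f = g.
Proof.
move=> /fpsP fg; apply/fpsP => n; have := fg n.+1; rewrite !fcoefM.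
rewrite !big_ord_recl !mul0r !add0r !mul1r /= !subSS !subn0.
by rewrite !big1 ?addr0 // => i _; rewrite mul0r.
Qed.

(** As a ring morphism it lets a polynomial over [K] be evaluated at a series, by way of
    [map_poly fps_const]. *)
Definition fps_const (c : K) : fps K := FPS (fun n => if n is 0 then c else 0).

Lemma fcoef_constM c f n : fcoef (fps_const c * f) n = c * fcoef f n.
Proof.
by rewrite fcoefM big_ord_recl subn0 big1 ?addr0 // => i _; rewrite mul0r.
Qed.

Fact fps_const_is_additive : additive fps_const.
Proof. by move=> a b; apply/fpsP => -[|n] //=; rewrite subr0. Qed.

Fact fps_const_is_monoid_morphism : monoid_morphism fps_const.
Proof.
split=> [|a b]; first by apply/fpsP => -[].
by apply/fpsP => -[|n]; rewrite fcoef_constM //= mulr0.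
Qed.

HB.instance Definition _ :=
  GRing.isAdditive.Build K (fps K) fps_const fps_const_is_additive.
HB.instance Definition _ := GRing.isMonoidMorphism.Build K (fps K) fps_const
  fps_const_is_monoid_morphism.

Lemma fcoef_sum (I : Type) (r : seq I) (P : pred I) (F : I -> fps K) n :
  fcoef (\sum_(i <- r | P i) F i) n = \sum_(i <- r | P i) fcoef (F i) n.
Proof. by elim/big_rec2: _ => //= i _ y _ <-. Qed.

Lemma fcoef_comp f g n :
  fcoef (fps_comp f g) n = \sum_(k < n.+1) fcoef f k * fcoef (g ^+ k) n.
Proof. by []. Qed.

(** The powers [g ^+ k] with k > n do not reach degree n, so the coefficients of [p] above n are
    invisible there. Laws of composition thus follow from laws of polynomial evaluation. *)
Lemma fcoef_comp_poly f g p n : fcoef g 0 = 0 ->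
  (forall k, (k <= n)%N -> p`_k = fcoef f k) ->
  fcoef (fps_comp f g) n = fcoef (map_poly fps_const p).[g] n.
Proof.
move=> g0 pf; rewrite (@horner_coef_wide _ (maxn (size p) n.+1)); last first.
  by rewrite (leq_trans (size_poly _ _)) ?leq_maxl.
rewrite fcoef_sum fcoef_comp (big_ord_widen_cond (maxn (size p) n.+1) xpredT
  (fun k => fcoef f k * fcoef (g ^+ k) n)) ?leq_maxr //.
rewrite big_mkcond; apply: eq_bigr => -[k ?] _; rewrite [nat_of_ord _]/= andTb.
rewrite coef_map fcoef_constM; case: ifP => [kn|/negbT]; first by rewrite pf.
by rewrite -leqNgt => nk; rewrite fcoef_exp_lt ?mulr0.
Qed.

Lemma fcoef_trunc N f k : (k <= N)%N -> (fps_trunc N f)`_k = fcoef f k.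
Proof. by move=> kN; rewrite coef_poly ltnS kN. Qed.

(** In degree n both series may be replaced by truncations, and polynomial evaluation is
    multiplicative. *)
Lemma fps_compM f g h : fcoef h 0 = 0 ->
  fps_comp (f * g) h = fps_comp f h * fps_comp g h.
Proof.
move=> h0; apply/fpsP => n.
rewrite (@fcoef_comp_poly _ _ (fps_trunc n f * fps_trunc n g)) //; last first.
  by move=> k kn; rewrite -fps_mul_trunc.
rewrite rmorphM hornerM !fcoefM; apply: eq_bigr => -[k /= kn] _.
congr (_ * _); symmetry; apply: fcoef_comp_poly => // j jk; apply: fcoef_trunc; lia.
Qed.

Lemma fps_compD f g h : fps_comp (f + g) h = fps_comp f h + fps_comp g h.
Proof.
by apply/fpsP => n /=; rewrite -big_split; apply: eq_bigr => k _; rewrite mulrDl.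
Qed.

Lemma fps_comp_const c h : fps_comp (fps_const c) h = fps_const c.
Proof.
apply/fpsP => n; rewrite fcoef_comp big_ord_recl expr0 big1 ?addr0; last first.
  by move=> i _; rewrite mul0r.
by case: n => [|n]; rewrite fcoef1 ?mulr1 ?mulr0.
Qed.

Lemma fps_comp1 h : fps_comp 1 h = 1.
Proof. by rewrite -(rmorph1 fps_const) fps_comp_const. Qed.

Lemma fps_comp_zl h : fcoef h 0 = 0 -> fps_comp z h = h.
Proof.
move=> h0; apply/fpsP => -[|n]; rewrite fcoef_comp; first by rewrite big_ord1 mul0r h0.
rewrite !big_ord_recl mul0r add0r mul1r big1 ?addr0 ?expr1 // => i _.
by rewrite mul0r.
Qed.

Lemma fcoef_zX k n : fcoef (z ^+ k) n = (n == k)%:R.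
Proof.
elim: k n => [|k IH] n; first by rewrite fcoef1.
rewrite exprS fcoefM; case: n => [|n]; first by rewrite big_ord1 mul0r.
rewrite !big_ord_recl mul0r add0r mul1r big1 ?addr0 => [|i _]; last by rewrite mul0r.
by rewrite /= subSS subn0 IH eqSS.
Qed.

Lemma fps_comp_zr f : fps_comp f z = f.
Proof.
apply/fpsP => n; rewrite fcoef_comp big_ord_recr fcoef_zX eqxx mulr1.
rewrite big1 => [|[k kn] _]; first exact: add0r.
by rewrite fcoef_zX gtn_eqF ?mulr0.
Qed.

Lemma fcoef_comp0 f g : fcoef (fps_comp f g) 0 = fcoef f 0.
Proof. by rewrite fcoef_comp big_ord1 expr0 mulr1. Qed.

Lemma fps_compA f g h : fcoef g 0 = 0 -> fcoef h 0 = 0 ->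
  fps_comp (fps_comp f g) h = fps_comp f (fps_comp g h).
Proof.
move=> g0 h0; apply/fpsP => n.
have gh0 : fcoef (fps_comp g h) 0 = 0 by rewrite fcoef_comp0.
rewrite (@fcoef_comp_poly f _ (fps_trunc n f)) //; last exact: fcoef_trunc.
transitivity (fcoef (fps_comp (map_poly fps_const (fps_trunc n f)).[g] h) n).
  rewrite !fcoef_comp; apply: eq_bigr => -[k /= kn] _; congr (_ * _).
  by apply: fcoef_comp_poly => // j jk; apply: fcoef_trunc; lia.
(* Only a polynomial is left in place of [f]. Composition with [h] respects sums, products and
   constants, so it passes through a Horner scheme. *)
congr (fcoef _ n); elim/poly_ind: (fps_trunc n f) => [|p c IH].
  by rewrite rmorph0 !horner0 -(rmorph0 fps_const) fps_comp_const.
rewrite !rmorphD !rmorphM /= map_polyX map_polyC /= !hornerE.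
by rewrite fps_compD fps_compM // fps_comp_const IH.
Qed.

End FpsComposition.

(** * Cancellation and units for power series over a field *)

Section FpsField.
Variable K : fieldType.
Implicit Types f g h : fps K.

Lemma fps_mulI f g h : fcoef h 0 != 0 -> f * h = g * h -> f = g.
Proof.
move=> /fps_mul_solve-/(_ (g * h))[k [_ kU]] /kU <-.
exact: kU.
Qed.

Lemma fps_comp_inj f g h : fcoef h 0 = 0 -> fcoef h 1 != 0 ->
  fps_comp f h = fps_comp g h -> f = g.
Proof.
move=> h0 h1; have [k [_ kU]] := fps_comp_solve (fps_comp g h) h0 h1.
by move=> /kU <-; apply: kU.
Qed.

Lemma fps_unit f : fcoef f 0 != 0 -> exists g, g * f = 1.
Proof. by move=> /(fps_mul_solve 1)[g [gf _]]; exists g. Qed.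

End FpsField.

(* [fps] already carries a commutative ring structure, so noncommutative
   coefficients need a separate type. *)
Record series (A : Type) := Series { scoef : nat -> A }.
Arguments Series {A} _.
Arguments scoef {A} _ _.

HB.instance Definition _ (A : Type) := gen_eqMixin (series A).
HB.instance Definition _ (A : Type) := gen_choiceMixin (series A).

Lemma seriesP (A : Type) (f g : series A) : scoef f =1 scoef g <-> f = g.
Proof. by split=> [|->//]; case: f g => [f] [g] /= /funext ->. Qed.

(** * Power series with noncommutative coefficients, and geometric series *)

Section SeriesRing.
Variable A : nzRingType.
Implicit Types f g h : series A.

Definition series_zero : series A := Series (fun=> 0).
Definition series_opp f := Series (fun n => - scoef f n).
Definition series_add f g := Series (fun n => scoef f n + scoef g n).

Let addA : associative series_add.
Proof. by move=> f g h; apply/seriesP => n /=; rewrite addrA. Qed.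
Let addC : commutative series_add.
Proof. by move=> f g; apply/seriesP => n /=; rewrite addrC. Qed.
Let add0 : left_id series_zero series_add.
Proof. by move=> f; apply/seriesP => n /=; rewrite add0r. Qed.
Let addN : left_inverse series_zero series_opp series_add.
Proof. by move=> f; apply/seriesP => n /=; rewrite addNr. Qed.

HB.instance Definition _ :=
  GRing.isZmodule.Build (series A) addA addC add0 addN.

Definition series_const (a : A) := Series (fun n => if n is 0 then a else 0).
Definition series_mul f g :=
  Series (fun n => \sum_(k < n.+1) scoef f k * scoef g (n - k)%N).

Let trunc n f : {poly A} := \poly_(i < n.+1) scoef f i.

Let mul_trunc_le n k f g : (k <= n)%N ->
  scoef (series_mul f g) k = (trunc n f * trunc n g)`_k.
Proof.
move=> kn; rewrite coefM; apply: eq_bigr => -[i /= ik] _.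
by rewrite !coef_poly !ifT //; lia.
Qed.

Let mulA : associative series_mul.
Proof.
move=> f g h; apply/seriesP => n.
transitivity (trunc n f * (trunc n g * trunc n h))`_n.
  rewrite coefM; apply: eq_bigr => -[k /= kn] _.
  by rewrite coef_poly kn -mul_trunc_le // leq_subr.
rewrite mulrA coefM; apply: eq_bigr => -[k /= kn] _.
by rewrite coef_poly ltnS leq_subr -mul_trunc_le.
Qed.
Let mul1 : left_id (series_const 1) series_mul.
Proof.
move=> f; apply/seriesP => n /=; rewrite big_ord_recl mul1r subn0 big1 ?addr0 //.
by move=> i _; rewrite mul0r.
Qed.
Let mulx1 : right_id (series_const 1) series_mul.
Proof.
move=> f; apply/seriesP => n /=; rewrite big_ord_recr /= subnn mulr1 big1 ?add0r //.
by move=> [i /= ik] _; case: (n - i)%N (subn_gt0 i n) => [|m]; rewrite ?ik ?mulr0.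
Qed.
Let mulDl : left_distributive series_mul series_add.
Proof.
move=> f g h; apply/seriesP => n /=; rewrite -big_split /=.
by apply: eq_bigr => i _; rewrite mulrDl.
Qed.
Let mulDr : right_distributive series_mul series_add.
Proof.
move=> f g h; apply/seriesP => n /=; rewrite -big_split /=.
by apply: eq_bigr => i _; rewrite mulrDr.
Qed.

HB.instance Definition _ :=
  GRing.Zmodule_isPzRing.Build (series A) mulA mul1 mulx1 mulDl mulDr.

Lemma scoefD f g n : scoef (f + g) n = scoef f n + scoef g n.
Proof. by []. Qed.
Lemma scoefN f n : scoef (- f) n = - scoef f n. Proof. by []. Qed.
Lemma scoef1 n : scoef (1 : series A) n = (n == 0%N)%:R.
Proof. by case: n. Qed.
Lemma scoefM f g n :
  scoef (f * g) n = \sum_(k < n.+1) scoef f k * scoef g (n - k)%N.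
Proof. by []. Qed.

Lemma scoef_sum (I : Type) (r : seq I) (P : pred I) (F : I -> series A) n :
  scoef (\sum_(i <- r | P i) F i) n = \sum_(i <- r | P i) scoef (F i) n.
Proof. by elim/big_rec2: _ => //= i _ y _ <-. Qed.

Lemma scoefM0 f g : scoef (f * g) 0 = scoef f 0 * scoef g 0.
Proof. by rewrite scoefM big_ord1. Qed.

Lemma scoef_constM a f n : scoef (series_const a * f) n = a * scoef f n.
Proof.
by rewrite scoefM big_ord_recl subn0 big1 ?addr0 // => i _; rewrite mul0r.
Qed.

Fact series_const_is_additive : additive series_const.
Proof. by move=> a b; apply/seriesP => -[|n] //=; rewrite subr0. Qed.

Fact series_const_is_monoid_morphism : monoid_morphism series_const.
Proof.
split=> [//|a b].
by apply/seriesP => -[|n]; rewrite scoef_constM //= mulr0.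
Qed.

HB.instance Definition _ :=
  GRing.isAdditive.Build A (series A) series_const series_const_is_additive.
HB.instance Definition _ := GRing.isMonoidMorphism.Build A (series A)
  series_const series_const_is_monoid_morphism.

Lemma scoef_exp_lt f n k : scoef f 0 = 0 -> (k < n)%N -> scoef (f ^+ n) k = 0.
Proof.
move=> f0; elim: n k => // n IH k kn; rewrite exprS scoefM big1 // => -[[|i] ik] _ /=.
  by rewrite f0 mul0r.
by rewrite IH ?mulr0 //; lia.
Qed.

(** When [f] has no constant term this is the full sum of its powers, since those beyond n vanish in
    degree n; hence it inverts [1 - f]. *)
Definition geom f := Series (fun n => \sum_(k < n.+1) scoef (f ^+ k) n).

Lemma scoef_geom f n N : scoef f 0 = 0 -> (n < N)%N ->
  scoef (geom f) n = scoef (\sum_(k < N) f ^+ k) n.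
Proof.
move=> f0 nN; rewrite scoef_sum /= (big_ord_widen N (fun k => scoef (f ^+ k) n)) //.
rewrite big_mkcond; apply: eq_bigr => -[k ?] _ /=; case: ifPn => //.
by rewrite -leqNgt => nk; rewrite scoef_exp_lt.
Qed.

Lemma geomMl f : scoef f 0 = 0 -> (1 - f) * geom f = 1.
Proof.
move=> f0; apply/seriesP => n.
(* Up to degree n a finite geometric sum suffices. The product telescopes to [1 - f ^+ n.+1], which
   agrees with 1 in degree n. *)
transitivity (scoef ((1 - f) * \sum_(k < n.+1) f ^+ k) n).
  rewrite !scoefM; apply: eq_bigr => -[k kn] _.
  by rewrite (@scoef_geom _ _ n.+1) // ltnS leq_subr.
by rewrite -opprB mulNr -subrX1 opprB scoefD scoefN scoef_exp_lt ?subr0.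
Qed.

Lemma geomMr f : scoef f 0 = 0 -> geom f * (1 - f) = 1.
Proof.
move=> f0; apply/seriesP => n.
transitivity (scoef ((\sum_(k < n.+1) f ^+ k) * (1 - f)) n).
  rewrite !scoefM; apply: eq_bigr => -[k /= kn] _.
  by congr (_ * _); apply: scoef_geom.
rewrite -[_ * _]/((\sum_(k < n.+1) f ^+ k) * (1 - f)).
(* Powers of [f] commute with [1 - f], which gives the telescoping form again. *)
have -> : (\sum_(k < n.+1) f ^+ k) * (1 - f) = (1 - f) * \sum_(k < n.+1) f ^+ k.
  apply/esym/commr_sum => i _; apply: commrX; apply: commr_sym.
  by apply: commrB => //; apply: commr1.
by rewrite -opprB mulNr -subrX1 opprB scoefD scoefN scoef_exp_lt ?subr0.
Qed.

End SeriesRing.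

(** * Scalar series as central elements, and functionals applied coefficientwise *)

Section SeriesScalars.
Variables (K : comNzRingType) (A : algType K).
Implicit Types (f g : fps K) (s t : series A).

Definition series_of (f : fps K) : series A := Series (fun n => (fcoef f n)%:A).

Fact series_of_is_additive : additive series_of.
Proof. by move=> f g; apply/seriesP => n /=; rewrite -scalerBl. Qed.

Fact series_of_is_monoid_morphism : monoid_morphism series_of.
Proof.
split=> [|f g]; apply/seriesP => n.
  by rewrite scoef1 /=; case: n => [|n] /=; rewrite ?scale1r ?scale0r.
rewrite /= scaler_suml; apply: eq_bigr => i _.
by rewrite -scalerAl mul1r scalerA.
Qed.

HB.instance Definition _ :=
  GRing.isAdditive.Build (fps K) (series A) series_of series_of_is_additive.
HB.instance Definition _ := GRing.isMonoidMorphism.Build (fps K) (series A)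
  series_of series_of_is_monoid_morphism.

Lemma scoef_ofM f s n :
  scoef (series_of f * s) n = \sum_(k < n.+1) fcoef f k *: scoef s (n - k)%N.
Proof. by rewrite scoefM; apply: eq_bigr => i _; rewrite mulr_algl. Qed.

Lemma series_of_comm f s : series_of f * s = s * series_of f.
Proof.
apply/seriesP => n; rewrite scoef_ofM scoefM (reindex_inj rev_ord_inj) /=.
apply: eq_bigr => -[k /= kn] _; rewrite mulr_algr subSS; congr (_ *: scoef s _); lia.
Qed.

Variable Phi : {scalar A}.

Definition series_map s : fps K := FPS (fun n => Phi (scoef s n)).

Lemma series_mapD s t : series_map (s + t) = series_map s + series_map t.
Proof. by apply/fpsP => n /=; rewrite linearD. Qed.

(** A functional applied coefficientwise is linear over scalar series, so Phi and Psi pass through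
    factors such as [fps_z]. *)
Lemma series_map_of f s : series_map (series_of f * s) = f * series_map s.
Proof.
apply/fpsP => n; rewrite fcoefM -[LHS]/(Phi (scoef (series_of f * s) n)).
by rewrite scoef_ofM linear_sum; apply: eq_bigr => i _; rewrite linearZ.
Qed.

Lemma series_map1 : Phi 1 = 1 -> series_map 1 = 1.
Proof. by move=> P1; apply/fpsP => -[|n] /=; rewrite ?P1 ?linear0. Qed.

End SeriesScalars.

(** * Series with coefficients in a unital subalgebra *)

Section SeriesInSubalgebra.
Variables (R : realType) (A : algType R[i]) (B : set A).
Hypothesis hB : unital_subalgebra B.

Lemma subalgebra1 : B 1.
Proof. by have [+ _ _] := hB; rewrite unfold_in => /set_mem. Qed.

Lemma subalgebra_lin a x y : B x -> B y -> B (a *: x + y).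
Proof.
move=> /mem_set Bx /mem_set By; apply/set_mem.
by have [_ + _] := hB => /(_ a x y); rewrite !unfold_in; apply.
Qed.

Lemma subalgebraM x y : B x -> B y -> B (x * y).
Proof.
move=> /mem_set Bx /mem_set By; apply/set_mem.
by have [_ _] := hB => /(_ x y); rewrite !unfold_in; apply.
Qed.

Lemma subalgebra0 : B 0.
Proof.
by rewrite -(addNr 1) -scaleN1r; apply: subalgebra_lin; apply: subalgebra1.
Qed.

Lemma subalgebraD x y : B x -> B y -> B (x + y).
Proof. by move=> Bx; rewrite -[x in x + _]scale1r; apply: subalgebra_lin. Qed.

Lemma subalgebraZ a x : B x -> B (a *: x).
Proof.
by move=> Bx; rewrite -[_ *: _]addr0; apply: subalgebra_lin => //; apply: subalgebra0.
Qed.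

Lemma subalgebra_sum (I : Type) (r : seq I) (P : pred I) (F : I -> A) :
  (forall i, B (F i)) -> B (\sum_(i <- r | P i) F i).
Proof.
by move=> BF; elim/big_rec: _ => [|i x _]; [exact: subalgebra0|exact: subalgebraD].
Qed.

Definition series_in (s : series A) := forall n, B (scoef s n).

Lemma series_in_const x : B x -> series_in (series_const x).
Proof. by move=> Bx [|n] //=; apply: subalgebra0. Qed.

Lemma series_inD s t : series_in s -> series_in t -> series_in (s + t).
Proof. by move=> Bs Bt n; apply: subalgebraD. Qed.

Lemma series_inN s : series_in s -> series_in (- s).
Proof. by move=> Bs n; rewrite scoefN -scaleN1r; apply: subalgebraZ. Qed.

Lemma series_inM s t : series_in s -> series_in t -> series_in (s * t).
Proof. by move=> Bs Bt n; apply: subalgebra_sum => i; apply: subalgebraM. Qed.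

Lemma series_in_of f : series_in (series_of A f).
Proof. by move=> n; apply/subalgebraZ/subalgebra1. Qed.

Lemma series_in_geom s : series_in s -> series_in (geom s).
Proof.
move=> Bs n; apply: subalgebra_sum => -[k /= _]; elim: k n => [|k IH] n.
  by apply: series_in_const; apply: subalgebra1.
by rewrite exprS; apply: series_inM.
Qed.

End SeriesInSubalgebra.

(** * Alternating centred words and their sums under c-freeness *)

Section AlternatingSpan.
Variables (R : realType) (A : algType R[i]) (Phi Psi : {scalar A}).
Variables (I : Type) (B : I -> set A).
Hypothesis hB : c_free Phi Psi B.
Implicit Types (a b : I) (v w x : A).

Let B_subalgebra b : unital_subalgebra (B b).
Proof. by case: hB => -[]. Qed.

(** The index [b] of the last letter is recorded because it decides which letters may be appended.
    The length [n.+1] excludes the empty word. *)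
Definition alternating_word b w := exists n eps (x : nat -> A),
  [/\ alternating_centred Psi B n.+1 eps x, eps n = b & w = \prod_(j < n.+1) x j].

Lemma word1 b x : B b x -> Psi x = 0 -> alternating_word b x.
Proof.
move=> Bx x0; exists 0%N, (fun=> b), (fun=> x); by split; rewrite ?big_ord1.
Qed.

(** The longer word is again alternating and centred. C-freeness for it and for [w] expresses both
    values of Phi as products over letters, which differ by the factor [Phi x]. *)
Lemma word_snoc a b w x : a <> b -> alternating_word a w -> B b x -> Psi x = 0 ->
  alternating_word b (w * x) /\ Phi (w * x) = Phi w * Phi x.
Proof.
move=> ab [n [eps [y [[yB epsN] epsn wE]]]] Bx x0.
pose eps' j := if (j <= n)%N then eps j else b.
pose y' j := if (j <= n)%N then y j else x.
have alt' : alternating_centred Psi B n.+2 eps' y'.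
  split=> [j|k]; rewrite ltnS => jn; rewrite /eps' /y'.
    by case: ifP => [jn'|_] //; apply: yB.
  move: jn; rewrite ltnS => kn; rewrite kn.
  move: kn; rewrite leq_eqVlt => /predU1P[->|kn]; first by rewrite ltnn epsn.
  by rewrite kn; apply: epsN.
(* Stated for a general [f], as it is used for the word itself and for its image under Phi. *)
have prodE (S : pzSemiRingType) (f : A -> S) :
    \prod_(j < n.+2) f (y' j) = (\prod_(j < n.+1) f (y j)) * f x.
  rewrite big_ord_recr /= {2}/y' ltnn; congr (_ * _).
  by apply: eq_bigr => -[j /= jn] _; rewrite /y' -ltnS jn.
have wxE : w * x = \prod_(j < n.+2) y' j by rewrite (prodE _ id) -wE.
split; first by exists n.+1, eps', y'; split=> //; rewrite /eps' ltnn.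
by case: hB => _ hPhi; rewrite wxE (hPhi _ eps') // (prodE _ Phi) wE (hPhi _ eps).
Qed.

Lemma word_centred b w : alternating_word b w -> Psi w = 0.
Proof.
by move=> [n [eps [x [alt _ ->]]]]; case: hB => -[_ hPsi] _; apply: (hPsi _ eps).
Qed.

(** Sums are enough for a span, since a letter can absorb a scalar. *)
Inductive alternating_span b : A -> Prop :=
| alternating_span0 : alternating_span b 0
| alternating_span_cons w v :
    alternating_word b w -> alternating_span b v -> alternating_span b (w + v).

Lemma alternating_spanD b v w :
  alternating_span b v -> alternating_span b w -> alternating_span b (v + w).
Proof.
move=> + wb; elim=> [|x y xb _ IH]; first by rewrite add0r.
by rewrite -addrA; constructor.
Qed.

Lemma alternating_span_sum b (J : Type) (r : seq J) (F : J -> A) :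
  (forall j, alternating_span b (F j)) -> alternating_span b (\sum_(j <- r) F j).
Proof.
by move=> bF; elim/big_rec: _ => [|i x _]; [constructor|exact: alternating_spanD].
Qed.

Lemma alternating_span_single b x : B b x -> Psi x = 0 -> alternating_span b x.
Proof.
move=> Bx x0; rewrite -[x]addr0; constructor; last by constructor.
exact: word1.
Qed.

Lemma alternating_span_snoc a b v x : a <> b ->
    alternating_span a v -> B b x -> Psi x = 0 ->
  alternating_span b (v * x) /\ Phi (v * x) = Phi v * Phi x.
Proof.
move=> ab + Bx x0; elim=> [|w {}v wa _ [IHb IHPhi]].
  by rewrite mul0r !linear0 mul0r; split=> //; constructor.
have [wxb wxPhi] := word_snoc ab wa Bx x0.
rewrite mulrDl !linearD /= mulrDl wxPhi IHPhi; split=> //.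
exact: alternating_span_cons.
Qed.

Lemma alternating_span_centred b v : alternating_span b v -> Psi v = 0.
Proof.
elim=> [|w {}v /word_centred w0 _ v0]; first by rewrite linear0.
by rewrite linearD /= w0 v0 addr0.
Qed.

Definition centred_series b s := series_in (B b) s /\ series_map Psi s = 0.

Definition series_span b s := forall n, alternating_span b (scoef s n).

Lemma centred_coef b s n : centred_series b s -> Psi (scoef s n) = 0.
Proof. by case=> _ /fpsP/(_ n). Qed.

Lemma centred_series_ofM b f s :
  centred_series b s -> centred_series b (series_of A f * s).
Proof.
move=> [sb s0]; split; last by rewrite series_map_of s0 mulr0.
by apply: series_inM => //; apply: series_in_of.
Qed.

Lemma series_span_single b s : centred_series b s -> series_span b s.
Proof.
by move=> sb n; apply: alternating_span_single; [case: sb|exact: centred_coef sb].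
Qed.

Lemma series_spanM a b s t : a <> b -> series_span a s -> centred_series b t ->
  series_span b (s * t) /\
  series_map Phi (s * t) = series_map Phi s * series_map Phi t.
Proof.
move=> ab sa tb.
have st i j := alternating_span_snoc ab (sa i) (proj1 tb j) (centred_coef j tb).
split=> [n|]; first by apply: alternating_span_sum => i; case: (st i (n - i)%N).
apply/fpsP => n; rewrite fcoefM -[LHS]/(Phi (scoef (s * t) n)) scoefM linear_sum.
by apply: eq_bigr => i _; case: (st i (n - i)%N).
Qed.

Lemma series_span_centred b s : series_span b s -> series_map Psi s = 0.
Proof. by move=> sb; apply/fpsP => n; apply: alternating_span_centred (sb n). Qed.

(** As [s] has no constant term, degree n of the equation involves [s1] on the right only in degrees
    below n. Strong induction applies, appending a letter from [s] and then one from [t]. *)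
Lemma series_span_fixpoint a b s0 s t s1 : a <> b ->
    series_span b s0 -> centred_series a s -> centred_series b t ->
    scoef s 0 = 0 -> s1 = s0 + s1 * (s * t) ->
  series_span b s1.
Proof.
move=> ab s0b sa tb s00 s1E; elim/ltn_ind => n IH; rewrite s1E scoefD.
apply: alternating_spanD => //; rewrite scoefM big_ord_recr subnn.
rewrite scoefM0 s00 mul0r mulr0 [X in alternating_span _ X]addr0.
apply: alternating_span_sum => -[k /= kn].
rewrite mulr_sumr; apply: alternating_span_sum => j; rewrite mulrA.
apply: (proj1 (alternating_span_snoc ab _ (proj1 tb _) (centred_coef _ tb))).
have ba : b <> a by move=> /esym.
apply: (proj1 (alternating_span_snoc ba _ (proj1 sa _) (centred_coef _ sa))).
exact: IH.
Qed.

Hypotheses (hPhi : Phi 1 = 1) (hPsi : Psi 1 = 1).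

(** The series r = (1 + t2) (1 - s t)^-1 - 1 solves r = t2 + s t + r s t, so its coefficients are
    sums of words ending in [b], and c = 1 + s2 + r + r s2. Phi is multiplicative on these words, so
    the equation for r becomes (1 + Phi(r)) (1 - Phi(s) Phi(t)) = 1 + Phi(t2), while Phi(c) = (1 +
    Phi(s2)) (1 + Phi(r)). *)
Lemma alternating_resolvent a b s s2 t t2 (c := (1 + t2) * geom (s * t) * (1 + s2)) :
    a <> b -> centred_series a s -> centred_series a s2 ->
    centred_series b t -> centred_series b t2 -> scoef s 0 = 0 ->
  series_map Psi c = 1 /\
  series_map Phi c * (1 - series_map Phi s * series_map Phi t) =
    (1 + series_map Phi s2) * (1 + series_map Phi t2).
Proof.
move=> ab sa s2a tb t2b s0.
have ba : b <> a by move=> /esym.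
have st0 : scoef (s * t) 0 = 0 by rewrite scoefM0 s0 mul0r.
pose r := (1 + t2) * geom (s * t) - 1.
have rE : r = (t2 + s * t) + r * (s * t).
  have gE : geom (s * t) = 1 + geom (s * t) * (s * t).
    by apply/eqP; rewrite -subr_eq -{1}[geom _]mulr1 -mulrBr geomMr.
  rewrite /r {1}gE mulrBl [1 * (s * t)]mul1r -[_ * _ * (s * t)]mulrA.
  rewrite [X in X - 1 = _]mulrDr mulr1 addrAC [1 + t2]addrC addrK -addrA.
  by rewrite [s * t + _]addrC subrK.
have cE : c = 1 + s2 + (r + r * s2).
  rewrite /c -[X in X * _](subrK 1) -/r mulrDl mul1r mulrDr mulr1.
  by rewrite addrC.
clearbody r.
have [stb stPhi] := series_spanM ab (series_span_single sa) tb.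
have s0b : series_span b (t2 + s * t).
  by move=> n; apply: alternating_spanD => //; apply: series_span_single.
have rb : series_span b r.
  apply: (series_span_fixpoint ab s0b sa tb s0 rE).
have [rsa rsPhi] := series_spanM ba rb sa.
have [_ rstPhi] := series_spanM ab rsa tb.
have [rs2a rs2Phi] := series_spanM ba rb s2a.
have rPhi : series_map Phi r = series_map Phi t2 +
    (1 + series_map Phi r) * (series_map Phi s * series_map Phi t).
  rewrite {1}rE !series_mapD stPhi mulrA rstPhi rsPhi; ring.
rewrite cE !series_mapD !series_map1 // (series_span_centred rb).
rewrite (series_span_centred rs2a) (proj2 s2a) !addr0; split=> //.
rewrite rs2Phi; apply/eqP; rewrite -subr_eq0; apply/eqP.
(* The difference of the two sides is 1 + Phi(s2) times the defect in the equation [rPhi], which is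
   zero. *)
transitivity ((1 + series_map Phi s2) * (series_map Phi r - (series_map Phi t2 +
    (1 + series_map Phi r) * (series_map Phi s * series_map Phi t)))).
  ring.
by rewrite -rPhi subrr mulr0.
Qed.

End AlternatingSpan.

(** * Resolvents of affine series and their relation to moment series *)

Section AffineResolvent.
Variables (R : realType) (A : algType R[i]).
Implicit Types (Phi : {scalar A}) (X : A) (f g s d : fps R[i]).

Local Notation z := (fps_z R[i]).
Local Notation Z := (series_of A z).

Definition affine_series s d X : series A :=
  series_of A s * series_const X - series_of A d.

Definition resolvent s d X : series A := geom (Z * affine_series s d X).

Lemma scoef_zM0 (x : series A) : scoef (Z * x) 0 = 0.
Proof. by rewrite scoefM0 /= scale0r mul0r. Qed.

Lemma fcoef_zM0 f : fcoef (z * f) 0 = 0.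
Proof. by rewrite fcoefM big_ord1 mul0r. Qed.

(** Scalar series are central, so the k-th power is f^k X^k and Phi turns it into f^k times the k-th
    moment. The summand k = 0 gives the 1, as [moment_series] starts in degree 1. *)
Lemma series_map_geom Phi X f : Phi 1 = 1 ->
  series_map Phi (geom (series_of A f * series_const X)) =
    1 + fps_comp (moment_series Phi X) f.
Proof.
move=> P1; have powE k n : scoef ((series_of A f * series_const X) ^+ k) n =
    fcoef (f ^+ k) n *: X ^+ k.
  rewrite exprMn_comm; last exact: series_of_comm.
  rewrite -!rmorphXn scoef_ofM big_ord_recr subnn /= big1 ?add0r //.
  move=> [i /= ik] _; case: (n - i)%N (subn_gt0 i n) => [|m] ni; last exact: scaler0.
  by rewrite ik in ni.
apply/fpsP => n; rewrite fcoefD fcoef_comp.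
rewrite -[LHS]/(Phi (\sum_(k < n.+1) scoef ((series_of A f * series_const X) ^+ k) n)).
rewrite linear_sum !big_ord_recl powE /= mul0r add0r linearZ /= expr0 P1 mulr1.
by congr (_ + _); apply: eq_bigr => k _; rewrite powE linearZ /= mulrC.
Qed.

(** The series [f] is zeta = u s / (1 + u d), with the division cleared. *)
Lemma resolventE s d X f : f * (1 + z * d) = z * s ->
  series_of A (1 + z * d) * resolvent s d X =
    geom (series_of A f * series_const X).
Proof.
move=> fE; set L := geom _; set E := series_of A _.
have f0 : fcoef f 0 = 0.
  have := congr1 (fun h => fcoef h 0) fE.
  by rewrite fcoef_zM0 fcoefM big_ord1 fcoefD fcoef_zM0 addr0 mulr1.
have LE : (1 - series_of A f * series_const X) * L = 1.
  by apply: geomMl; rewrite scoefM0 /= f0 scale0r mul0r.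
have EE : E * (1 - series_of A f * series_const X) = 1 - Z * affine_series s d X.
  rewrite mulrBr mulr1 mulrA /E -rmorphM [_ * f]mulrC fE !rmorphD !rmorphM rmorph1.
  by rewrite /affine_series mulrBr mulrA opprB addrA.
rewrite -[LHS]mulr1 -LE mulrA [E * _]series_of_comm -[_ * E * _]mulrA EE.
by rewrite geomMr ?mul1r ?scoef_zM0.
Qed.

Lemma series_map_resolvent Phi s d X f : Phi 1 = 1 -> f * (1 + z * d) = z * s ->
  (1 + z * d) * series_map Phi (resolvent s d X) =
    1 + fps_comp (moment_series Phi X) f.
Proof. by move=> P1 fE; rewrite -series_map_of (resolventE _ fE) series_map_geom. Qed.

Lemma series_in_affine (B : set A) s d X : unital_subalgebra B -> B X ->
  series_in B (affine_series s d X).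
Proof.
move=> hB BX; apply: series_inD => //.
  by apply: series_inM => //; [exact: series_in_of|exact: series_in_const].
by apply: series_inN => //; apply: series_in_of.
Qed.

End AffineResolvent.

(** * Combining the resolvents of two c-free series *)

Section Combination.
Variables (R : realType) (A : algType R[i]) (Phi Psi : {scalar A}).
Variables (I : Type) (B : I -> set A).
Hypothesis hB : c_free Phi Psi B.
Hypotheses (hPhi : Phi 1 = 1) (hPsi : Psi 1 = 1).

Local Notation z := (fps_z R[i]).
Local Notation Z := (series_of A z).

Let B_subalgebra b : unital_subalgebra (B b).
Proof. by case: hB => -[]. Qed.

Lemma geom_zE (p : series A) : geom (Z * p) = 1 + Z * (geom (Z * p) * p).
Proof.
rewrite mulrA [Z * geom _]series_of_comm -mulrA; apply/eqP.
by rewrite -subr_eq -{1}[geom _]mulr1 -mulrBr geomMr // scoef_zM0.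
Qed.

(** By [geom_zE], applying Psi to the resolvent gives 1 + z Psi(a p) = 1, and z can be cancelled. *)
Lemma centred_geom b p : series_in (B b) p -> series_map Psi (geom (Z * p)) = 1 ->
  centred_series Psi B b (geom (Z * p) * p).
Proof.
move=> pb p1; split.
  apply: series_inM => //; apply: series_in_geom => //; apply: series_inM => //.
  exact: series_in_of.
apply: fps_zM_inj; apply: (addrI 1).
by rewrite -series_map_of -{1}(series_map1 hPsi) -series_mapD -geom_zE p1 mulr0 addr0.
Qed.

(** This is [alternating_resolvent] for s = k a p, t = b q, s2 = z a p and t2 = z b q, where 1 + s2
    and 1 + t2 are the resolvents a and b themselves. The witnesses [f] and [g] are Phi(a p) and
    Phi(b q). *)
Lemma combined_resolvent a b p q (k : fps R[i]) : a <> b ->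
    series_in (B a) p -> series_in (B b) q -> fcoef k 0 = 0 ->
    series_map Psi (geom (Z * p)) = 1 -> series_map Psi (geom (Z * q)) = 1 ->
  exists c f g,
    [/\ c * (1 - Z * (p + q) + series_of A (z ^+ 2 - k) * (p * q)) = 1,
        series_map Psi c = 1, series_map Phi (geom (Z * p)) = 1 + z * f,
        series_map Phi (geom (Z * q)) = 1 + z * g &
        series_map Phi c * (1 - k * f * g) = (1 + z * f) * (1 + z * g)].
Proof.
move=> ab pa qb k0 p1 q1.
have pE := geom_zE p; have qE := geom_zE q.
have pMr := geomMr (scoef_zM0 p); have qMr := geomMr (scoef_zM0 q).
have pMl := geomMl (scoef_zM0 p).
have sa := centred_geom pa p1; have tb := centred_geom qb q1.
set P := geom (Z * p) in pE pMr pMl p1 sa *.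
set Q := geom (Z * q) in qE qMr q1 tb *.
have ksa := centred_series_ofM hB k sa.
have ks0 : scoef (series_of A k * (P * p)) 0 = 0.
  by rewrite scoefM0 /= k0 scale0r mul0r.
have [] := alternating_resolvent hB hPhi hPsi ab ksa
  (centred_series_ofM hB z sa) tb (centred_series_ofM hB z tb) ks0.
have D0 : scoef (series_of A k * (P * p) * (Q * q)) 0 = 0.
  by rewrite scoefM0 ks0 mul0r.
have DMr := geomMr D0.
set D := series_of A k * (P * p) * (Q * q) in D0 DMr *.
rewrite -pE -qE => cPsi cPhi.
exists (Q * geom D * P), (series_map Phi (P * p)), (series_map Phi (Q * q)); split => //.
- rewrite (_ : 1 - _ + _ = (1 - Z * p) * (1 - D) * (1 - Z * q)); last first.
    (* Since [q] commutes with [1 - Z * q], the outer factors cancel the two resolvents inside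
       [D]. *)
    have DE : (1 - Z * p) * D * (1 - Z * q) = series_of A k * (p * q).
      have qZ : q * (1 - Z * q) = (1 - Z * q) * q.
        by rewrite mulrBr mulrBl mulr1 mul1r mulrA -series_of_comm.
      rewrite /D !mulrA -[_ * series_of A k]series_of_comm.
      rewrite -[_ * q * (1 - _)]mulrA qZ !mulrA -[_ * (1 - _) * P]mulrA pMl mulr1.
      by rewrite -[_ * Q * (1 - _)]mulrA qMr mulr1.
    rewrite [_ * (1 - D)]mulrBr mulr1 [RHS]mulrBl DE rmorphB [_ * (p * q)]mulrBl.
    rewrite addrA; congr (_ - _).
    rewrite mulrBr mulr1 mulrBl mul1r mulrDr opprD opprB !addrA.
    rewrite expr2 rmorphM -[Z * p * _]mulrA [p * (Z * q)]mulrA -[p * Z]series_of_comm.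
    rewrite !mulrA; exact: addrAC.
  rewrite -[_ * P * _]mulrA -[_ * (1 - D) * _]mulrA [P * _]mulrA pMr mul1r.
  by rewrite !mulrA -[_ * _ * (1 - D)]mulrA DMr mulr1 qMr.
- by rewrite {1}pE series_mapD series_map1 // series_map_of.
- by rewrite {1}qE series_mapD series_map1 // series_map_of.
by move: cPhi; rewrite !series_map_of.
Qed.
End Combination.

(** * The functional equations after a change of variable *)

Section FunctionalEquations.
Variable K : fieldType.
Implicit Types (f g m M r t : fps K).
Local Notation z := (fps_z K).

Lemma fcoefM0 f g : fcoef (f * g) 0 = fcoef f 0 * fcoef g 0.
Proof. by rewrite fcoefM big_ord1. Qed.

Lemma fcoefM1 f g : fcoef f 0 = 0 -> fcoef (f * g) 1 = fcoef f 1 * fcoef g 0.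
Proof. by move=> f0; rewrite fcoefM !big_ord_recl big_ord0 f0 mul0r add0r addr0. Qed.

Lemma fcoefD1 f : fcoef f 0 = 0 -> fcoef (1 + f) 0 = 1.
Proof. by move=> f0; rewrite fcoefD f0 addr0. Qed.

Section Additive.
Variables m r f : fps K.
Hypotheses (m0 : fcoef m 0 = 0) (r0 : fcoef r 0 = 0) (fE : f * (1 + r) = z).

Let f0 : fcoef f 0 = 0.
Proof. by have := congr1 (fcoef^~ 0%N) fE; rewrite fcoefM0 fcoefD1 // mulr1. Qed.
Let f1 : fcoef f 1 != 0.
Proof.
have := congr1 (fcoef^~ 1%N) fE; rewrite fcoefM1 // fcoefD1 // mulr1 => ->.
exact: oner_neq0.
Qed.
Let g0 : fcoef (z * (1 + m)) 0 = 0.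
Proof. by rewrite fcoefM0 mul0r. Qed.
Let g1 : fcoef (z * (1 + m)) 1 != 0.
Proof. by rewrite fcoefM1 // fcoefD1 // mulr1 oner_neq0. Qed.

(** Under either condition f = z / (1 + r) and z (1 + m) are inverse to each other under
    composition. Substituting one of them turns each equation into the other. *)
Lemma R_equationE : m = fps_comp r (z * (1 + m)) <-> fps_comp m f = r.
Proof.
set g : fps K := z * (1 + m); split=> [rg|mf].
  apply: (fps_comp_inj g0 g1); rewrite fps_compA // -/g -rg.
  suff -> : fps_comp f g = z by rewrite fps_comp_zr.
  apply: (@fps_mulI _ _ _ (1 + m)); first by rewrite fcoefD1 ?oner_neq0.
  have := congr1 (fun h => fps_comp h g) fE.
  by rewrite fps_compM // fps_compD fps_comp1 -rg fps_comp_zl.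
apply: (fps_comp_inj f0 f1); rewrite mf fps_compA // fps_compM //.
by rewrite fps_compD fps_comp1 fps_comp_zl // mf fE fps_comp_zr.
Qed.

Lemma cR_equationE M c : fps_comp m f = r ->
  fps_comp c (z * (1 + m)) * (1 + M) = M * (1 + m) <->
  c * (1 + fps_comp M f) = fps_comp M f * (1 + r).
Proof.
move=> mf; set g : fps K := z * (1 + m).
have gf : fps_comp g f = z.
  by rewrite fps_compM // fps_compD fps_comp1 fps_comp_zl // mf.
have -> : c * (1 + fps_comp M f) = fps_comp (fps_comp c g * (1 + M)) f.
  by rewrite fps_compM // fps_compA // gf fps_comp_zr fps_compD fps_comp1.
have -> : fps_comp M f * (1 + r) = fps_comp (M * (1 + m)) f.
  by rewrite fps_compM // fps_compD fps_comp1 mf.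
by split=> [->|/(fps_comp_inj f0 f1)].
Qed.

End Additive.

Section Multiplicative.
Variables m t f : fps K.
Hypotheses (m0 : fcoef m 0 = 0) (t0 : fcoef t 0 != 0) (fE : f * (1 + z) * t = z).

Let f0 : fcoef f 0 = 0.
Proof.
have /eqP := congr1 (fcoef^~ 0%N) fE.
by rewrite !fcoefM0 fcoefD1 // mulr1 mulf_eq0 (negPf t0) orbF => /eqP.
Qed.
Let f1 : fcoef f 1 != 0.
Proof.
apply/eqP => f1; have /eqP := congr1 (fcoef^~ 1%N) fE.
by rewrite -mulrA fcoefM1 // f1 mul0r eq_sym oner_eq0.
Qed.

Lemma T_equation_moment : fps_comp m f = z ->
  fps_divz m = fps_comp t m * (1 + m).
Proof.
move=> mf; apply: fps_zM_inj; rewrite fps_divzK //.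
have fm : fps_comp f m = z.
  by apply: (fps_comp_inj f0 f1); rewrite fps_compA // mf fps_comp_zr fps_comp_zl.
have := congr1 (fun h => fps_comp h m) fE.
rewrite !fps_compM // fps_compD fps_comp1 fps_comp_zl // fm => {1}<-.
by rewrite -mulrA [_ * fps_comp t m]mulrC.
Qed.

(** The constant term of the equation gives m_1 = t_0, which is nonzero, so [m] can be cancelled on
    the right. It then suffices that f(m) = z, which follows by composing [fE] with [m]. *)
Lemma T_equation_inverse : fps_divz m = fps_comp t m * (1 + m) ->
  fps_comp m f = z.
Proof.
move=> tE; have m1 : fcoef m 1 != 0.
  have := congr1 (fcoef^~ 0%N) tE.
  by rewrite fcoefM0 fcoefD1 // mulr1 fcoef_comp0 /= => ->.
apply: (fps_comp_inj m0 m1); rewrite fps_compA // fps_comp_zl //.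
suff -> : fps_comp f m = z by rewrite fps_comp_zr.
apply: (@fps_mulI _ _ _ (fps_divz m)) => //.
rewrite fps_divzK // tE [fps_comp t m * _]mulrC mulrA.
have := congr1 (fun h => fps_comp h m) fE.
by rewrite !fps_compM // fps_compD fps_comp1 fps_comp_zl.
Qed.

(** Multiply by z and substitute [f]: since m(f) = z, the term c(m) becomes [c]. *)
Lemma cT_equationE M c : fcoef M 0 = 0 -> fps_comp m f = z ->
  fps_comp c m * (1 + M) = fps_divz M <->
  f * c * (1 + fps_comp M f) = fps_comp M f.
Proof.
move=> M0 mf.
have cE : f * c * (1 + fps_comp M f) =
    fps_comp (z * (fps_comp c m * (1 + M))) f.
  rewrite !fps_compM // fps_comp_zl // fps_compA // mf fps_comp_zr.
  by rewrite fps_compD fps_comp1 mulrA.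
split=> [E|]; first by rewrite cE E fps_divzK.
rewrite cE => /(fps_comp_inj f0 f1) E; apply: fps_zM_inj.
by rewrite fps_divzK.
Qed.

End Multiplicative.
End FunctionalEquations.

(** * Transforms characterised by values of resolvents *)

Section TransformsByResolvent.
Variables (R : realType) (A : algType R[i]) (Phi Psi : {scalar A}).
Hypotheses (hPhi : Phi 1 = 1) (hPsi : Psi 1 = 1).
Implicit Types (X : A) (r s t c f : fps R[i]).
Local Notation z := (fps_z R[i]).

Let eq_1D (f g : fps R[i]) : f = 1 + g -> g = f - 1.
Proof. by move=> ->; rewrite addrAC subrr add0r. Qed.

(** With zeta = z / (1 + r), [series_map_resolvent] reads (1 + r) Psi(a) = 1 + m(zeta), so Psi(a) =
    1 means m(zeta) = r. *)
Lemma is_R_resolvent X r : is_R Psi X r <->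
  fcoef r 0 = 0 /\ series_map Psi (resolvent 1 (fps_divz r) X) = 1.
Proof.
suff rP : fcoef r 0 = 0 -> is_R Psi X r <->
    series_map Psi (resolvent 1 (fps_divz r) X) = 1.
  split=> [rR|[r0 /rP]]; last exact.
  have r0 : fcoef r 0 = 0.
    by have /fpsP/(_ 0%N) := rR; rewrite fcoef_comp0 => <-.
  by split=> //; apply/rP.
move=> r0; have [e eE] : exists e, e * (1 + r) = 1.
  by apply: fps_unit; rewrite fcoefD1 ?oner_neq0.
have fE : z * e * (1 + r) = z by rewrite -mulrA eE mulr1.
have dE : z * e * (1 + z * fps_divz r) = z * 1 by rewrite fps_divzK // fE mulr1.
have := series_map_resolvent X hPsi dE; rewrite fps_divzK // => E.
rewrite /is_R (R_equationE _ r0 fE) //; split=> [mE|F1].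
  apply: (@fps_mulI _ _ _ (1 + r)); first by rewrite fcoefD1 ?oner_neq0.
  by rewrite mulrC E mE mul1r.
by apply: (addrI 1); rewrite -E F1 mulr1.
Qed.

(** Substituting M(zeta) = (1 + r) Phi(a) - 1 into the equation after the change of variable leaves
    a common factor 1 + r, which is a unit. *)
Lemma is_cR_resolvent X r c : is_R Psi X r ->
  is_cR Phi Psi X c <->
  series_map Phi (resolvent 1 (fps_divz r) X) * (1 + r - c) = 1.
Proof.
move=> rR; have [r0 _] := (is_R_resolvent X r).1 rR.
have u0 : fcoef (1 + r) 0 != 0 by rewrite fcoefD1 ?oner_neq0.
have [e eE] := fps_unit u0.
have fE : z * e * (1 + r) = z by rewrite -mulrA eE mulr1.
have dE : z * e * (1 + z * fps_divz r) = z * 1 by rewrite fps_divzK // fE mulr1.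
have := series_map_resolvent X hPhi dE; rewrite fps_divzK //.
move: (series_map Phi _) => F E.
have mE : fps_comp (moment_series Psi X) (z * e) = r by apply/(R_equationE _ r0 fE).
rewrite /is_cR (cR_equationE r0 fE) // -E.
have -> : fps_comp (moment_series Phi X) (z * e) = (1 + r) * F - 1.
  exact: eq_1D.
split=> H.
  apply: (@fps_mulI _ _ _ (1 + r)) => //; rewrite mul1r.
  transitivity ((1 + r) * F * (1 + r) - c * ((1 + r) * F)); first by ring.
  by rewrite H; ring.
transitivity ((1 + r) * F * (1 + r) - (1 + r) * (F * (1 + r - c))); first by ring.
by rewrite H; ring.
Qed.

Let one_z0 : fcoef (1 + z) 0 != 0.
Proof. by rewrite fcoefD1 // oner_neq0. Qed.

Let T_arg s t : s * t = 1 -> exists f, f * (1 + z) * t = z /\ f * (1 + z * 1) = z * s.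
Proof.
move=> st; have [e eE] := fps_unit one_z0; exists (e * (z * s)); rewrite mulr1.
have -> : e * (z * s) * (1 + z) = z * s by rewrite mulrAC eE mul1r.
by rewrite -mulrA st mulr1.
Qed.

Let fcoef_unit0 s t : s * t = 1 -> fcoef t 0 != 0.
Proof.
move=> st; apply/eqP => t0; have /eqP := congr1 (fun h => fcoef h 0) st.
by rewrite fcoefM0 t0 mulr0 eq_sym oner_eq0.
Qed.

(** Here (1 + z) Psi(a) = 1 + m(zeta), so Psi(a) = 1 means m(zeta) = z. *)
Lemma is_T_resolvent X s t : s * t = 1 ->
  is_T Psi X t <-> series_map Psi (resolvent s 1 X) = 1.
Proof.
move=> st; have t0 := fcoef_unit0 st; have [f [fE dE]] := T_arg st.
have := series_map_resolvent X hPsi dE; rewrite mulr1 => E; split=> H.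
  apply: (@fps_mulI _ _ _ (1 + z)) => //.
  by rewrite mulrC E (T_equation_inverse _ t0 fE) // mul1r.
by apply: (T_equation_moment _ t0 fE) => //; apply: (addrI 1); rewrite -E H mulr1.
Qed.

Lemma is_cT_resolvent X s t c : s * t = 1 -> is_T Psi X t ->
  let F := series_map Phi (resolvent s 1 X) in
  is_cT Phi Psi X c <-> z * s * c * F = (1 + z) * F - 1.
Proof.
move=> st tT F; have t0 := fcoef_unit0 st; have [f [fE dE]] := T_arg st.
have := series_map_resolvent X hPhi dE; rewrite mulr1 -/F => E.
rewrite /is_cT (cT_equationE _ t0 fE) //; last exact: (T_equation_inverse _ t0 fE).
rewrite -E; have -> : fps_comp (moment_series Phi X) f = (1 + z) * F - 1.
  exact: eq_1D.
suff -> : f * c * ((1 + z) * F) = z * s * c * F by [].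
by rewrite -dE mulr1; ring.
Qed.

(** Makes T-transforms invertible when Psi is nonzero at the element, and later shows that Psi(X Y)
    is nonzero. *)
Lemma is_T_coef0 X t : is_T Psi X t -> fcoef t 0 = Psi X.
Proof.
move=> /fpsP/(_ 0%N); rewrite fcoefM0 fcoefD1 // mulr1 fcoef_comp0 => <-.
by rewrite /= expr1.
Qed.

End TransformsByResolvent.

(** * Transforms of sums and products of c-free elements *)

Section CFreeTransforms.
Variables (R : realType) (A : algType R[i]) (Phi Psi : {scalar A}).
Hypotheses (hPhi : Phi 1 = 1) (hPsi : Psi 1 = 1).
Variables (X Y : A).
Hypothesis hXY : c_free_elements Phi Psi X Y.
Local Notation z := (fps_z R[i]).
Local Notation Z := (series_of A z).

Let gen_in (W : A) s d : series_in (subalgebra_gen W) (affine_series s d W).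
Proof.
apply: series_in_affine; first exact: subalgebra_gen_unital.
by move=> S [_]; apply.
Qed.

Lemma combined_affine_resolvent s d s' d' k : fcoef k 0 = 0 ->
    series_map Psi (resolvent s d X) = 1 -> series_map Psi (resolvent s' d' Y) = 1 ->
  let p := affine_series s d X in let q := affine_series s' d' Y in
  exists c f g,
    [/\ c * (1 - Z * (p + q) + series_of A (z ^+ 2 - k) * (p * q)) = 1,
        series_map Psi c = 1, series_map Phi (resolvent s d X) = 1 + z * f,
        series_map Phi (resolvent s' d' Y) = 1 + z * g &
        series_map Phi c * (1 - k * f * g) = (1 + z * f) * (1 + z * g)].
Proof.
move=> k0 X1 Y1; apply: (combined_resolvent hXY hPhi hPsi (a := true) (b := false)) => //;
  exact: gen_in.
Qed.

Lemma resolvent_uniq c s d (W : A) :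
  c * (1 - Z * affine_series s d W) = 1 -> c = resolvent s d W.
Proof.
move=> cE; rewrite -[LHS]mulr1 -(geomMl (scoef_zM0 (affine_series s d W))).
by rewrite mulrA cE mul1r.
Qed.

Lemma additive_transforms rX rY cX cY :
    is_R Psi X rX -> is_R Psi Y rY -> is_cR Phi Psi X cX -> is_cR Phi Psi Y cY ->
  is_R Psi (X + Y) (rX + rY) /\ is_cR Phi Psi (X + Y) (cX + cY).
Proof.
move=> hrX hrY /(is_cR_resolvent hPhi hPsi _ hrX) + /(is_cR_resolvent hPhi hPsi _ hrY).
have [rX0 X1] := (is_R_resolvent hPsi _ _).1 hrX.
have [rY0 Y1] := (is_R_resolvent hPsi _ _).1 hrY.
(* The choice k = z^2 removes the term [p * q]. *)
have zz0 : fcoef (z ^+ 2) 0 = 0 by rewrite expr2 fcoefM0 mul0r.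
have [c [f [g [cE cPsi -> -> cPhi]]]] := combined_affine_resolvent zz0 X1 Y1.
have {}cE : c = resolvent 1 (fps_divz (rX + rY)) (X + Y).
  apply: resolvent_uniq; rewrite -[RHS]cE subrr rmorph0 mul0r addr0.
  congr (_ * (1 - Z * _)); rewrite /affine_series rmorph1 !mul1r rmorphD.
  rewrite -[fps_divz (rX + rY)]/(fps_divz rX + fps_divz rY) rmorphD.
  by rewrite opprD addrACA.
have rXY : is_R Psi (X + Y) (rX + rY).
  by apply/(is_R_resolvent hPsi); rewrite fcoefD rX0 rY0 addr0 -cE.
move=> EX EY; split=> //; apply/(is_cR_resolvent hPhi hPsi _ rXY); rewrite -cE.
set E := 1 + rX - cX in EX *; set E' := 1 + rY - cY in EY *.
have -> : 1 + (rX + rY) - (cX + cY) = E + E' - 1 by rewrite /E /E'; ring.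
(* Here E and E' are the inverses of Phi(a) = 1 + z f and Phi(b) = 1 + z g. Thus z f E = 1 - E and z
   g E' = 1 - E', whence (1 - z^2 f g) E E' = E + E' - 1. *)
transitivity (series_map Phi c * (E * ((1 + z * g) * E') + ((1 + z * f) * E) * E'
  - ((1 + z * f) * E) * ((1 + z * g) * E'))); first by rewrite EX EY; ring.
transitivity (series_map Phi c * (1 - z ^+ 2 * f * g) * E * E'); first by ring.
rewrite cPhi; transitivity (((1 + z * f) * E) * ((1 + z * g) * E')); first by ring.
by rewrite EX EY mulr1.
Qed.

Lemma multiplicative_transforms tX tY cX cY :
    fcoef tX 0 != 0 -> fcoef tY 0 != 0 ->
    is_T Psi X tX -> is_T Psi Y tY -> is_cT Phi Psi X cX -> is_cT Phi Psi Y cY ->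
  is_T Psi (X * Y) (tX * tY) /\ is_cT Phi Psi (X * Y) (cX * cY).
Proof.
move=> /fps_unit[sX stX] /fps_unit[sY stY] hX hY.
move=> /(is_cT_resolvent hPhi _ stX hX) + /(is_cT_resolvent hPhi _ stY hY).
have X1 := (is_T_resolvent hPsi X stX).1 hX.
have Y1 := (is_T_resolvent hPsi Y stY).1 hY.
(* With k = z (1 + z) the coefficient of [p * q] is -z, which leaves 1 - z (p + q + p q). *)
have zz0 : fcoef (z * (1 + z)) 0 = 0 by rewrite fcoefM0 mul0r.
have [c [f [g [cE cPsi -> -> cPhi]]]] := combined_affine_resolvent zz0 X1 Y1.
have stXY : sX * sY * (tX * tY) = 1 by rewrite mulrACA stX stY mulr1.
have {}cE : c = resolvent (sX * sY) 1 (X * Y).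
  apply: resolvent_uniq; rewrite -[RHS]cE; congr (_ * _).
  have -> : z ^+ 2 - z * (1 + z) = - z by ring.
  rewrite rmorphN mulNr -addrA -opprD -mulrDr; congr (1 - Z * _).
  rewrite /affine_series rmorph1.
  set a := _ * series_const X; set b := _ * series_const Y.
  have -> : series_of A (sX * sY) * series_const (X * Y) = a * b.
    rewrite /a /b !rmorphM -!mulrA; congr (_ * _).
    by rewrite !mulrA series_of_comm.
  rewrite [(a - 1) * _]mulrBl mul1r -addrA [b - 1 + _]addrC subrK.
  by rewrite mulrBr mulr1 addrC subrKA.
have tXY : is_T Psi (X * Y) (tX * tY).
  by apply/(is_T_resolvent hPsi _ stXY); rewrite -cE.
move=> EX EY; split=> //; apply/(is_cT_resolvent hPhi _ stXY tXY).
rewrite -cE; set F := series_map Phi c in cPhi *.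
(* Both sides of the equation for the c-transform are divisible by z once Phi(a) is written as 1 + z
   f. *)
have {}EX : sX * cX * (1 + z * f) = 1 + (1 + z) * f.
  apply: fps_zM_inj; rewrite !mulrA EX; ring.
have {}EY : sY * cY * (1 + z * g) = 1 + (1 + z) * g.
  apply: fps_zM_inj; rewrite !mulrA EY; ring.
(* Multiplying by this unit replaces Phi(c) by (1 + z f) (1 + z g), after which a polynomial
   identity in z, f and g remains. *)
apply: (@fps_mulI _ _ _ (1 - z * (1 + z) * f * g)).
  by rewrite fcoefD fcoefN !fcoefM0 !mul0r subr0 oner_neq0.
transitivity (z * (sX * cX) * (sY * cY) * (F * (1 - z * (1 + z) * f * g))).
  by ring.
rewrite cPhi.
transitivity (z * (sX * cX * (1 + z * f)) * (sY * cY * (1 + z * g))); first by ring.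
rewrite EX EY.
transitivity ((1 + z) * (F * (1 - z * (1 + z) * f * g)) - (1 - z * (1 + z) * f * g)).
  by rewrite cPhi; ring.
by ring.
Qed.

End CFreeTransforms.

Theorem corollary4p2 (R : realType) (A : algType R[i]) (Phi Psi : {scalar A})
    (hPhi : Phi 1 = 1) (hPsi : Psi 1 = 1) (X Y : A)
    (hXY : c_free_elements Phi Psi X Y) :
  (R_transform Psi (X + Y) = R_transform Psi X + R_transform Psi Y /\
   cR_transform Phi Psi (X + Y) =
     cR_transform Phi Psi X + cR_transform Phi Psi Y) /\
  (Psi X <> 0 -> Psi Y <> 0 ->
   T_transform Psi (X * Y) = T_transform Psi X * T_transform Psi Y /\
   cT_transform Phi Psi (X * Y) =
     cT_transform Phi Psi X * cT_transform Phi Psi Y).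
Proof.
have exists_unique_eq (P : fps R[i] -> Prop) (f g : fps R[i]) :
    (exists! h, P h) -> P f -> P g -> f = g.
  by move=> [h [_ hU]] /hU <- /hU.
split.
  have [rXY cXY] := additive_transforms hPhi hPsi hXY (R_transformP Psi X)
    (R_transformP Psi Y) (cR_transformP Phi Psi X) (cR_transformP Phi Psi Y).
  split; first exact: exists_unique_eq (R_transform_unique _ _) (R_transformP _ _) rXY.
  exact: exists_unique_eq (cR_transform_unique _ _ _) (cR_transformP _ _ _) cXY.
move=> X0 Y0; have tX := T_transformP X0; have tY := T_transformP Y0.
have tX0 : fcoef (T_transform Psi X) 0 != 0 by rewrite (is_T_coef0 tX); apply/eqP.
have tY0 : fcoef (T_transform Psi Y) 0 != 0 by rewrite (is_T_coef0 tY); apply/eqP.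
have [tXY cXY] := multiplicative_transforms hPhi hPsi hXY tX0 tY0 tX tY
  (cT_transformP Phi X0) (cT_transformP Phi Y0).
(* The product of the T-transforms solves the equation for [X * Y], and its constant term is Psi(X
   Y). This excludes the default value in the transforms of [X * Y]. *)
have XY0 : Psi (X * Y) <> 0.
  by apply/eqP; rewrite -(is_T_coef0 tXY) fcoefM0 mulf_neq0.
split; first exact: exists_unique_eq (T_transform_unique XY0) (T_transformP XY0) tXY.
exact: exists_unique_eq (cT_transform_unique _ XY0) (cT_transformP _ XY0) cXY.
Qed.
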